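(* Let $A,B,X,Y\in\mathcal{M}_n$ with $A\in\Pi_\gamma$, where $\gamma\in[0,\pi/2)$ and $\gamma\neq0$. Then, for either choice of sign, $$w(AXB\pm BYA)\ \leq\ 2\sqrt{2}\,(\sin\gamma)\,\|B\|\,\max\{\|X\|,\|Y\|\}\,\sqrt{w^2(A)-\frac{\csc^2\gamma}{2}\left(\|\Im(A)\|^2-\|\Re(A)\|^2\right)}.$$
   Context: $\mathcal{M}_n$ is the algebra of $n\times n$ complex matrices and $\|\cdot\|$ is the operator norm on $\mathcal{M}_n$ induced by the Euclidean norm on $\mathbb{C}^n$. For $A\in\mathcal{M}_n$: the numerical range is $W(A)=\{\langle Ax,x\rangle : x\in\mathbb{C}^n,\ \|x\|=1\}$ and the numerical radius is $w(A)=\sup\{|\langle Ax,x\rangle| : x\in\mathbb{C}^n,\ \|x\|=1\}$; $w^2(A)$ means $(w(A))^2$. The Cartesian parts are $\Re(A)=\frac{A+A^*}{2}$ and $\Im(A)=\frac{A-A^*}{2i}$. For $\gamma\in[0,\pi/2)$ let $S_\gamma=\{z\in\mathbb{C} : \Re z>0,\ |\Im z|\leq(\tan\gamma)\Re z\}$; $A\in\Pi_\gamma$ means $W(A)\subseteq S_\gamma$. *)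

(* Defs.v *)
From mathcomp Require Import all_boot all_order all_algebra.
From mathcomp Require Import complex.
From mathcomp Require Import all_classical all_reals all_analysis.

Set Implicit Arguments.
Unset Strict Implicit.
Unset Printing Implicit Defensive.

Import Order.TTheory GRing.Theory Num.Theory.

Local Open Scope classical_set_scope.
Local Open Scope complex_scope.
Local Open Scope sesquilinear_scope.
Local Open Scope ring_scope.

(* The inner product on C^n, linear in the first argument; [v ^t*] is the
   conjugate transpose. *)
Definition cdot (R : realType) (n : nat) (u v : 'cV[R[i]]_n) : R[i] :=
  (v ^t* *m u) 0 0.

(* [Normc.normc] is the R-valued modulus, whereas [`|z|] lives in R[i]. *)
Definition enorm (R : realType) (n : nat) (x : 'cV[R[i]]_n) : R :=
  Num.sqrt (\sum_(i < n) Normc.normc (x i 0) ^+ 2).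

Definition opnorm (R : realType) (n : nat) (A : 'M[R[i]]_n) : R :=
  sup [set enorm (A *m x) | x in [set x : 'cV[R[i]]_n | enorm x = 1]].

Definition numrange (R : realType) (n : nat) (A : 'M[R[i]]_n) : set R[i] :=
  [set cdot (A *m x) x | x in [set x : 'cV[R[i]]_n | enorm x = 1]].

Definition numradius (R : realType) (n : nat) (A : 'M[R[i]]_n) : R :=
  sup [set Normc.normc z | z in numrange A].

Definition Re_mx (R : realType) (n : nat) (A : 'M[R[i]]_n) : 'M[R[i]]_n :=
  2%:R^-1 *: (A + A ^t*).

Definition Im_mx (R : realType) (n : nat) (A : 'M[R[i]]_n) : 'M[R[i]]_n :=
  (2%:R * 'i%C)^-1 *: (A - A ^t*).

Definition sector (R : realType) (gamma : R) : set R[i] :=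
  [set z : R[i] | 0 < complex.Re z /\ `|complex.Im z| <= tan gamma * complex.Re z].

Definition sectorial (R : realType) (n : nat) (gamma : R) (A : 'M[R[i]]_n)
    : Prop :=
  numrange A `<=` sector gamma.

Definition csc (R : realType) (x : R) : R := (sin x)^-1.

(* Main.v *)
(** For a unit vector [x], Cauchy-Schwarz bounds [|<(AXB + s BYA)x, x>|], where
    [|s| = 1], by [max(|X|, |Y|) |B| (|A^* x| + |Ax|)].  By the parallelogram
    law [|Ax|^2 + |A^* x|^2 = 2 (|Re(A) x|^2 + |Im(A) x|^2)], so this is at most
    [2 max(|X|, |Y|) |B| sqrt(|Re A|^2 + |Im A|^2)].  Every [z] in the sector
    satisfies [|Im z| <= sin(gamma) |z|]; as [Im A] is Hermitian this gives
    [|Im A| <= sin(gamma) w(A)], and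
    [|Re A|^2 + |Im A|^2 <= 2 sin(gamma)^2 w(A)^2 - |Im A|^2 + |Re A|^2]. *)

Require Import Defs.
From mathcomp Require Import all_boot all_order all_algebra.
From mathcomp Require Import complex ring lra.
From mathcomp Require Import all_classical all_reals all_analysis.

Set Implicit Arguments.
Unset Strict Implicit.
Unset Printing Implicit Defensive.

Import Order.TTheory GRing.Theory Num.Theory Normc.

Local Open Scope complex_scope.
Local Open Scope ring_scope.
Local Open Scope sesquilinear_scope.

(** * Real inequalities and suprema *)

Lemma sum_mul_le_sqrt (R : rcfType) (I : finType) (a b : I -> R) :
  \sum_i a i * b i <=
  Num.sqrt (\sum_i a i ^+ 2) * Num.sqrt (\sum_i b i ^+ 2).
Proof.
rewrite -sqrtrM ?sumr_ge0 // => [|i _]; last exact: sqr_ge0.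
apply: (le_trans (ler_norm _)); rewrite -sqrtr_sqr ler_wsqrtr //.
(* Lagrange's identity *)
have : 0 <= \sum_i \sum_j (a i * b j - a j * b i) ^+ 2.
  by apply: sumr_ge0 => i _; apply: sumr_ge0 => j _; exact: sqr_ge0.
have -> : \sum_i \sum_j (a i * b j - a j * b i) ^+ 2 =
    \sum_i \sum_j a i ^+ 2 * b j ^+ 2 + \sum_i \sum_j b i ^+ 2 * a j ^+ 2 -
    2 * (\sum_i \sum_j (a i * b i) * (a j * b j)).
  rewrite mulr_sumr -big_split -sumrB; apply: eq_bigr => i _ /=.
  rewrite mulr_sumr -big_split -sumrB; apply: eq_bigr => j _ /=; ring.
rewrite -!big_distrlr /=; nra.
Qed.

(** The factor [2 ^+ 2] joins the 2 of [(a + b)^2 <= 2 (a^2 + b^2)] to the 2 of the parallelogram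
    law. *)
Lemma sqr_add_le (R : realFieldType) (a b c d e f : R) :
  a ^+ 2 + b ^+ 2 = 2 * (c ^+ 2 + d ^+ 2) ->
  c ^+ 2 <= e ^+ 2 -> d ^+ 2 <= f ^+ 2 ->
  (a + b) ^+ 2 <= 2 ^+ 2 * (e ^+ 2 + f ^+ 2).
Proof. by have := sqr_ge0 (a - b); rewrite sqrrB sqrrD; lra. Qed.

(** Meant for [p = |Im A|], [q = |Re A|], [w = w(A)^2], with [s] the sine and [c] the cosecant. The
    right side equals [2 s^2 w - p^2 + q^2], and [2 p^2 <= 2 s^2 w]. *)
Lemma cartesian_radicand_le (R : realFieldType) (p q w s c : R) :
  s ^+ 2 * c ^+ 2 = 1 -> p ^+ 2 <= s ^+ 2 * w ->
  q ^+ 2 + p ^+ 2 <= 2 * s ^+ 2 * (w - c ^+ 2 / 2 * (p ^+ 2 - q ^+ 2)).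
Proof.
move=> sc hp.
have -> : 2 * s ^+ 2 * (w - c ^+ 2 / 2 * (p ^+ 2 - q ^+ 2)) =
    2 * (s ^+ 2 * w) - s ^+ 2 * c ^+ 2 * (p ^+ 2 - q ^+ 2) by field.
by rewrite sc mul1r; lra.
Qed.

(* [sup] is [0] on empty sets and on sets without an upper bound. *)
Lemma sup_le_ge0 (R : realType) (E : set R) (c : R) :
  0 <= c -> (forall a, E a -> a <= c) -> sup E <= c.
Proof.
have [->|/set0P E0] := eqVneq E set0; first by rewrite sup0.
by move=> _ Ec; exact: ge_sup.
Qed.

Lemma sup_ge0 (R : realType) (E : set R) :
  (forall a, E a -> 0 <= a) -> 0 <= sup E.
Proof.
move=> Epos; have [supE|nsupE] := pselect (has_sup E); last by rewrite sup_out.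
have [[a Ea] Eub] := supE.
by rewrite (le_trans (Epos a Ea)) //; exact: ub_le_sup.
Qed.

(** * Complex modulus, inner product and Euclidean norm *)

Section Euclidean.
Variable R : realType.
Local Notation C := R[i].

Lemma normc_ge0 (z : C) : 0 <= normc z.
Proof. by case: z => a b; exact: sqrtr_ge0. Qed.

Lemma sqr_normcE (z : C) : normc z ^+ 2 = complex.Re z ^+ 2 + complex.Im z ^+ 2.
Proof. by case: z => a b /=; rewrite sqr_sqrtr // addr_ge0 ?sqr_ge0. Qed.

Lemma normc_conj (z : C) : normc z^* = normc z.
Proof. by case: z => a b /=; rewrite sqrrN. Qed.

Lemma normc_real (a : R) : normc a%:C = `|a|.
Proof. by rewrite /= expr0n addr0 sqrtr_sqr. Qed.

Lemma Re_realM (a : R) (z : C) : complex.Re (a%:C * z) = a * complex.Re z.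
Proof. by case: z => p q /=; rewrite mul0r subr0. Qed.

Lemma le_normc_sum (I : finType) (F : I -> C) :
  normc (\sum_i F i) <= \sum_i normc (F i).
Proof.
elim/big_rec2: _ => [|i y x _ le_xy]; first by rewrite normc0.
by apply: le_trans (le_normcD _ _) _; rewrite lerD2l.
Qed.

Section Vectors.
Variable n : nat.
Implicit Types (u v x y : 'cV[C]_n) (A : 'M[C]_n).

Lemma cdotE u v : cdot u v = \sum_i (v i 0)^* * u i 0.
Proof. by rewrite /cdot mxE; apply: eq_bigr => i _; rewrite !mxE. Qed.

Lemma cdotDl u v x : cdot (u + v) x = cdot u x + cdot v x.
Proof. by rewrite /cdot mulmxDr mxE. Qed.

Lemma cdotZl c u x : cdot (c *: u) x = c * cdot u x.
Proof. by rewrite /cdot -scalemxAr mxE. Qed.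

Lemma cdotC u v : cdot u v = (cdot v u)^*.
Proof.
rewrite !cdotE rmorph_sum; apply: eq_bigr => i _.
by rewrite rmorphM /= conjCK mulrC.
Qed.

Lemma cdotDr u v x : cdot x (u + v) = cdot x u + cdot x v.
Proof. by rewrite !(cdotC x) cdotDl rmorphD. Qed.

Lemma cdotZr c u x : cdot x (c *: u) = c^* * cdot x u.
Proof. by rewrite !(cdotC x) cdotZl rmorphM. Qed.

Lemma cdot_mulmxl A u v : cdot (A *m u) v = cdot u (A ^t* *m v).
Proof.
rewrite /cdot trmx_mul map_mxM mulmxA; congr ((_ *m _ *m _) _ _).
by apply/matrixP => i j; rewrite !mxE /= conjCK.
Qed.

Lemma enorm_ge0 x : 0 <= enorm x.
Proof. exact: sqrtr_ge0. Qed.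

Lemma sqr_enorm x : enorm x ^+ 2 = \sum_i normc (x i 0) ^+ 2.
Proof. by rewrite sqr_sqrtr // sumr_ge0 // => i _; exact: sqr_ge0. Qed.

Lemma cdotxx x : cdot x x = (enorm x ^+ 2)%:C.
Proof.
rewrite sqr_enorm rmorph_sum cdotE; apply: eq_bigr => i _.
by rewrite mulrC sqr_normcE /= add_Re2_Im2; exact/esym/sqr_normc.
Qed.

Lemma enormZ (c : C) x : enorm (c *: x) = normc c * enorm x.
Proof.
apply/eqP; rewrite -(@eqrXn2 _ 2) ?mulr_ge0 ?enorm_ge0 ?normc_ge0 //.
rewrite exprMn !sqr_enorm mulr_sumr; apply/eqP/eq_bigr => i _.
by rewrite mxE normcM exprMn.
Qed.

Lemma enorm0 : enorm (0 : 'cV[C]_n) = 0.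
Proof. by rewrite -(scale0r 0) enormZ normc0 mul0r. Qed.

Lemma enorm_eq0 x : enorm x = 0 -> x = 0.
Proof.
move=> x0; have /eqP := sqr_enorm x; rewrite x0 expr0n eq_sym.
rewrite psumr_eq0 => [/allP e|i _]; last exact: sqr_ge0.
apply/matrixP => i j; rewrite (ord1 j) mxE; apply: eq0_normc; apply/eqP.
by have := e i (mem_index_enum _); rewrite /= sqrf_eq0.
Qed.

Lemma normc_cdot_le u v : normc (cdot u v) <= enorm u * enorm v.
Proof.
rewrite cdotE (le_trans (le_normc_sum _)) // mulrC.
apply: le_trans (sum_mul_le_sqrt _ _).
by apply: ler_sum => i _; rewrite normcM normc_conj.
Qed.

Lemma enorm_parallelogram u v :
  enorm (u + v) ^+ 2 + enorm (u - v) ^+ 2 = 2 * (enorm u ^+ 2 + enorm v ^+ 2).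
Proof.
rewrite !sqr_enorm -!big_split /= mulr_sumr; apply: eq_bigr => i _.
rewrite !mxE !sqr_normcE; case: (u i 0) (v i 0) => [a b] [c d] /=; ring.
Qed.

(** Carries bounds on unit vectors, the only ones the suprema see, over to all vectors by
    homogeneity. *)
Lemma normalize_enorm x : x != 0 -> exists2 y, enorm y = 1 & x = (enorm x)%:C *: y.
Proof.
move=> x0; have n0 : enorm x != 0 by apply: contra_neq x0; exact: enorm_eq0.
exists ((enorm x)^-1%:C *: x).
  by rewrite enormZ normc_real ger0_norm ?mulVf ?invr_ge0 ?enorm_ge0.
by rewrite scalerA -rmorphM divff // scale1r.
Qed.

(** * Operator norm, numerical radius and quadratic forms *)

(** Coordinates of a unit vector have modulus at most 1, so each coordinate of [A *m x] is at most
    an absolute row sum. This makes the set defining [opnorm] bounded, hence its [sup] a genuine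
    supremum. *)
Lemma ubound_enorm_mulmx A x : enorm x = 1 ->
  enorm (A *m x) <= Num.sqrt (\sum_i (\sum_j normc (A i j)) ^+ 2).
Proof.
move=> x1; apply: ler_wsqrtr; apply: ler_sum => i _.
rewrite ler_sqr ?nnegrE ?normc_ge0 ?sumr_ge0 // => [|j _]; last exact: normc_ge0.
rewrite mxE (le_trans (le_normc_sum _)) //; apply: ler_sum => j _.
rewrite normcM ler_piMr ?normc_ge0 // -(@expr_le1 _ 2) ?normc_ge0 //.
rewrite -(expr1n _ 2) -x1 sqr_enorm (bigD1 j) //= lerDl sumr_ge0 // => k _.
exact: sqr_ge0.
Qed.

Lemma opnorm_ub A x : enorm x = 1 -> enorm (A *m x) <= opnorm A.
Proof.
move=> x1; apply: ub_le_sup; last by exists x.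
by exists (Num.sqrt (\sum_i (\sum_j normc (A i j)) ^+ 2)) => _ [y y1 <-];
  exact: ubound_enorm_mulmx.
Qed.

Lemma opnorm_le A c : 0 <= c ->
  (forall x, enorm x = 1 -> enorm (A *m x) <= c) -> opnorm A <= c.
Proof. by move=> c0 Ac; apply: sup_le_ge0 => // _ [x x1 <-]; exact: Ac. Qed.

Lemma opnorm_ge0 A : 0 <= opnorm A.
Proof. by apply: sup_ge0 => // _ [x _ <-]; exact: enorm_ge0. Qed.

Lemma enorm_mulmx_le A x : enorm (A *m x) <= opnorm A * enorm x.
Proof.
have [->|/normalize_enorm [y y1 ->]] := eqVneq x 0.
  by rewrite mulmx0 !enorm0 mulr0.
rewrite -scalemxAr !enormZ y1 mulr1 mulrC ler_wpM2r ?normc_ge0 //.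
exact: opnorm_ub.
Qed.

Lemma numradius_ub A x : enorm x = 1 -> normc (cdot (A *m x) x) <= numradius A.
Proof.
move=> x1; apply: ub_le_sup; last by exists (cdot (A *m x) x) => //; exists x.
(* By Cauchy-Schwarz, [opnorm A] bounds the set whose supremum is the numerical radius. *)
exists (opnorm A) => _ [_ [y y1 <-] <-].
by rewrite (le_trans (normc_cdot_le _ _)) // y1 mulr1 opnorm_ub.
Qed.

Lemma numradius_le A c : 0 <= c ->
  (forall x, enorm x = 1 -> normc (cdot (A *m x) x) <= c) -> numradius A <= c.
Proof. by move=> c0 Ac; apply: sup_le_ge0 => // _ [_ [x x1 <-] <-]; exact: Ac. Qed.

Lemma numradius_ge0 A : 0 <= numradius A.
Proof. by apply: sup_ge0 => // _ [z _ <-]; exact: normc_ge0. Qed.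

(** The quadratic form is homogeneous of degree 2. Polarization needs this bound at [x + y] and
    [x - y], which are not unit vectors. *)
Lemma normr_Re_form_le A c x :
  (forall y, enorm y = 1 -> `|complex.Re (cdot (A *m y) y)| <= c) ->
  `|complex.Re (cdot (A *m x) x)| <= c * enorm x ^+ 2.
Proof.
move=> Ac; have [->|/normalize_enorm [y y1 ->]] := eqVneq x 0.
  by rewrite mulmx0 cdotxx !enorm0 expr0n mulr0 normr0.
rewrite -scalemxAr cdotZl cdotZr enormZ y1 mulr1 normc_real (ger0_norm (enorm_ge0 _)).
have -> : (enorm x)%:C^* = (enorm x)%:C :> C by exact: conjc_real.
rewrite mulrA -rmorphM Re_realM normrM mulrC -expr2 (ger0_norm (sqr_ge0 _)).
by rewrite ler_wpM2r ?sqr_ge0 ?Ac.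
Qed.

(* Polarization: [4 Re <Hx, y> = <H(x + y), x + y> - <H(x - y), x - y>], applied
   to a unit [x] and to the unit vector [y] in the direction of [Hx]. *)
Lemma opnorm_hermitian_le H c : H ^t* = H -> 0 <= c ->
  (forall x, enorm x = 1 -> `|complex.Re (cdot (H *m x) x)| <= c) -> opnorm H <= c.
Proof.
move=> Hh c0 Hc; apply: opnorm_le => // x x1.
have [->|/normalize_enorm [y y1 Hx]] := eqVneq (H *m x) 0.
  by rewrite enorm0.
have ReHxy : complex.Re (cdot (H *m x) y) = enorm (H *m x).
  by rewrite {1}Hx cdotZl cdotxx y1 Re_realM expr1n mulr1.
(* [H] moves across the inner product because it is Hermitian, and the real part ignores the
   conjugation. *)
have ReHyx : complex.Re (cdot (H *m y) x) = enorm (H *m x).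
  rewrite cdot_mulmxl Hh cdotC -ReHxy.
  by case: (cdot _ _).
have P := normr_Re_form_le (x + y) Hc; have M := normr_Re_form_le (x - y) Hc.
(* For unit [x] and [y], [|x + y|^2 + |x - y|^2 = 4]. The upper bound at [x + y] and the lower bound
   at [x - y] then give [4 |Hx| <= 4 c]. *)
have := enorm_parallelogram x y; rewrite x1 y1 expr1n.
move: P M; rewrite mulmxBr mulmxDr !(cdotDl, cdotDr).
rewrite -!(scaleN1r y) -!(scaleN1r (H *m y)) !(cdotDl, cdotDr, cdotZl, cdotZr).
rewrite rmorphN1 !mulN1r opprK !raddfD !raddfN /= ReHxy ReHyx.
rewrite !ler_norml => /andP[_ P] /andP[M _] E.
nra.
Qed.

End Vectors.
End Euclidean.

(** * Cartesian parts and the sector condition *)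

Section CartesianParts.
Variables (R : realType) (n : nat).
Implicit Types (A B X Y : 'M[R[i]]_n) (x : 'cV[R[i]]_n).

Lemma trmxCK A : A ^t* ^t* = A.
Proof. by apply/matrixP => i j; rewrite !mxE /= conjCK. Qed.

Lemma conj_2i : (2%:R * 'i%C : R[i])^* = - (2%:R * 'i%C).
Proof.
rewrite rmorphM /= conjC_nat -mulrN; congr (_ * _).
by apply/eqP; rewrite eq_complex /= oppr0 !eqxx.
Qed.

(** Taking adjoints changes the sign of both [2i] and the difference [A - A ^t*]. *)
Lemma Im_mx_hermitian A : (Im_mx A) ^t* = Im_mx A.
Proof.
rewrite /Im_mx; apply/matrixP => i j; rewrite !mxE rmorphM /= fmorphV /= conj_2i.
by rewrite rmorphB /= conjCK invrN mulNr -mulrN opprB.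
Qed.

(** With [z = <Ax, x>], the form of the adjoint is the conjugate of [z], and the difference of the
    two is [2i Im z]. This turns the sector condition into a bound on the form of [Im_mx A]. *)
Lemma Re_cdot_Im_mx A x :
  complex.Re (cdot (Im_mx A *m x) x) = complex.Im (cdot (A *m x) x).
Proof.
rewrite -scalemxAl cdotZl mulmxBl -scaleN1r cdotDl cdotZl mulN1r.
rewrite (cdot_mulmxl (A ^t*)) trmxCK (cdotC x).
have -> (z : R[i]) : z - z^* = 2%:R * 'i%C * (complex.Im z)%:C.
  by rewrite mulrAC; exact: subcJ.
rewrite mulrA mulVf ?mul1r // mulf_neq0 ?pnatr_eq0 //.
by rewrite eq_complex /= oner_eq0 andbF.
Qed.

Lemma normc2 : normc (2%:R : R[i]) = 2.
Proof. by rewrite -(rmorph_nat (real_complex R)) normc_real ger0_norm. Qed.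

Lemma normci : normc ('i%C : R[i]) = 1.
Proof. by rewrite /= expr0n expr1n add0r sqrtr1. Qed.

(** The sum and difference of [A *m x] and [A ^t* *m x] are [2 Re(A) x] and [2i Im(A) x]. *)
Lemma sum_sqr_enorm_cartesian A x :
  enorm (A *m x) ^+ 2 + enorm (A ^t* *m x) ^+ 2 =
  2 * (enorm (Re_mx A *m x) ^+ 2 + enorm (Im_mx A *m x) ^+ 2).
Proof.
rewrite -!scalemxAl !enormZ !exprMn mulmxDl mulmxBl !normcV normcM normc2 normci.
have := enorm_parallelogram (A *m x) (A ^t* *m x).
move: (enorm (A *m x)) (enorm (A ^t* *m x)) (enorm (_ + _)) (enorm (_ - _)) =>
  a b c d h.
by rewrite mulr1 -mulrDr h; field.
Qed.

(** With [u = A ^t* *m x], [|u|^2 = <x, Au> <= |A| |u|]; then divide by [|u|]. *)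
Lemma enorm_adjoint_le A x : enorm x = 1 -> enorm (A ^t* *m x) <= opnorm A.
Proof.
move=> x1; set u := A ^t* *m x.
have : enorm u ^+ 2 <= opnorm A * enorm u.
  rewrite -(ger0_norm (sqr_ge0 (enorm u))) -normc_real -cdotxx {1}/u.
  rewrite cdot_mulmxl trmxCK (le_trans (normc_cdot_le _ _)) // x1 mul1r.
  exact: enorm_mulmx_le.
have [->|] := eqVneq (enorm u) 0; first by rewrite opnorm_ge0.
by move=> u0; rewrite expr2 ler_pM2r // lt0r u0 enorm_ge0.
Qed.

(** The unimodular scalar [s] covers both signs at once. *)
Lemma numradius_mulmx_pair_le A B X Y (s : R[i]) (M : R) :
  normc s = 1 -> opnorm X <= M -> opnorm Y <= M ->
  numradius (A *m X *m B + s *: (B *m Y *m A)) <=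
  2 * opnorm B * M * Num.sqrt (opnorm (Re_mx A) ^+ 2 + opnorm (Im_mx A) ^+ 2).
Proof.
move=> s1 XM YM; set r := Num.sqrt _.
have M0 : 0 <= M := le_trans (opnorm_ge0 X) XM.
have r0 : 0 <= r by exact: sqrtr_ge0.
have B0 := opnorm_ge0 B.
apply: numradius_le => [|x x1]; first by rewrite !mulr_ge0.
(* Moving [A] across leaves [<XBx, A ^t* x>]. *)
have AXB : normc (cdot (A *m X *m B *m x) x) <= opnorm B * M * enorm (A ^t* *m x).
  rewrite -!mulmxA cdot_mulmxl; apply: le_trans (normc_cdot_le _ _) _.
  apply: ler_wpM2r; first exact: enorm_ge0.
  apply: le_trans (enorm_mulmx_le _ _) _; rewrite mulrC.
  by apply: ler_pM (enorm_ge0 _) (opnorm_ge0 _) _ XM; exact: opnorm_ub.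
(* Here [B] moves across, leaving [<YAx, B ^t* x>]; the adjoint of [B] costs no more than [|B|]. *)
have BYA : normc (cdot (B *m Y *m A *m x) x) <= opnorm B * M * enorm (A *m x).
  rewrite -!mulmxA cdot_mulmxl; apply: le_trans (normc_cdot_le _ _) _.
  rewrite mulrC -mulrA; apply: ler_pM (enorm_ge0 _) (enorm_ge0 _) _ _.
    exact: enorm_adjoint_le.
  apply: le_trans (enorm_mulmx_le _ _) _.
  by apply: ler_wpM2r YM; exact: enorm_ge0.
rewrite mulmxDl -scalemxAl cdotDl cdotZl; apply: le_trans (le_normcD _ _) _.
rewrite normcM s1 mul1r; apply: le_trans (lerD AXB BYA) _; rewrite -mulrDr.
have -> : 2 * opnorm B * M * r = opnorm B * M * (2 * r) by ring.
(* What remains is [|A ^t* x| + |Ax| <= 2 r], proved by comparing squares. *)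
apply: ler_wpM2l; first exact: mulr_ge0.
rewrite -ler_sqr ?nnegrE ?addr_ge0 ?mulr_ge0 ?enorm_ge0 // exprMn.
rewrite sqr_sqrtr ?addr_ge0 ?sqr_ge0 //.
have Rex : enorm (Re_mx A *m x) ^+ 2 <= opnorm (Re_mx A) ^+ 2.
  by rewrite ler_sqr ?nnegrE ?enorm_ge0 ?opnorm_ge0 ?opnorm_ub.
have Imx : enorm (Im_mx A *m x) ^+ 2 <= opnorm (Im_mx A) ^+ 2.
  by rewrite ler_sqr ?nnegrE ?enorm_ge0 ?opnorm_ge0 ?opnorm_ub.
rewrite addrC; exact: sqr_add_le (sum_sqr_enorm_cartesian A x) Rex Imx.
Qed.

Lemma opnorm_Im_mx_sectorial A (gamma : R) : 0 < gamma -> gamma < pi / 2 ->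
  sectorial gamma A -> opnorm (Im_mx A) <= sin gamma * numradius A.
Proof.
move=> g0 g1 hA.
have s0 : 0 < sin gamma by apply: sin_gt0_pihalf; rewrite g0.
have c0 : 0 < cos gamma.
  apply: cos_gt0_pihalf; rewrite g1 andbT (lt_trans _ g0) //.
  by rewrite oppr_lt0 divr_gt0 ?pi_gt0.
apply: opnorm_hermitian_le; first exact: Im_mx_hermitian.
  by rewrite mulr_ge0 ?numradius_ge0 // ltW.
move=> x x1; rewrite Re_cdot_Im_mx.
apply: (@le_trans _ _ (sin gamma * normc (cdot (A *m x) x))); last first.
  by rewrite ler_pM2l // numradius_ub.
have : sector gamma (cdot (A *m x) x) by apply: hA; exists x.
case: (cdot _ _) => a b [] /= a0; rewrite /tan => hb.
have {}hb : `|b| * cos gamma <= sin gamma * a.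
  by rewrite -ler_pdivlMr // mulrAC.
rewrite -ler_sqr ?nnegrE ?mulr_ge0 ?sqrtr_ge0 ?(ltW s0) //.
rewrite exprMn sqr_sqrtr ?addr_ge0 ?sqr_ge0 //.
(* With [cos^2 = 1 - sin^2], the squared sector inequality rearranges to
   [b^2 <= sin^2 (a^2 + b^2)]. *)
have : (`|b| * cos gamma) ^+ 2 <= (sin gamma * a) ^+ 2.
  by rewrite ler_sqr ?nnegrE ?mulr_ge0 ?(ltW s0, ltW c0, ltW a0).
rewrite !exprMn cos2sin2 real_normK ?num_real //; lra.
Qed.

End CartesianParts.

(** * The numerical radius inequality for both signs *)

Theorem theorem2p4 (R : realType) (n : nat) (gamma : R)
    (A B X Y : 'M[complex R]_n)
    (hgamma0 : 0 <= gamma) (hgamma1 : gamma < pi / 2) (hgamma : gamma <> 0)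
    (hA : sectorial gamma A) :
  numradius (A *m X *m B + B *m Y *m A) <=
    2 * Num.sqrt 2 * sin gamma * opnorm B * Num.max (opnorm X) (opnorm Y) *
    Num.sqrt (numradius A ^+ 2 -
      csc gamma ^+ 2 / 2 * (opnorm (Im_mx A) ^+ 2 - opnorm (Re_mx A) ^+ 2))
  /\
  numradius (A *m X *m B - B *m Y *m A) <=
    2 * Num.sqrt 2 * sin gamma * opnorm B * Num.max (opnorm X) (opnorm Y) *
    Num.sqrt (numradius A ^+ 2 -
      csc gamma ^+ 2 / 2 * (opnorm (Im_mx A) ^+ 2 - opnorm (Re_mx A) ^+ 2)).
Proof.
have g0 : 0 < gamma by rewrite lt0r hgamma0 andbT; apply/eqP.
(* Strict positivity makes [csc gamma] a true inverse of [sin gamma]. *)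
have s0 : 0 < sin gamma by apply: sin_gt0_pihalf; rewrite g0.
have XM : opnorm X <= Num.max (opnorm X) (opnorm Y) by rewrite le_max lexx.
have YM : opnorm Y <= Num.max (opnorm X) (opnorm Y) by rewrite le_max lexx orbT.
have hIm := opnorm_Im_mx_sectorial g0 hgamma1 hA.
have M0 := le_trans (opnorm_ge0 X) XM.
have hsqrt : Num.sqrt (opnorm (Re_mx A) ^+ 2 + opnorm (Im_mx A) ^+ 2) <=
    Num.sqrt 2 * sin gamma * Num.sqrt (numradius A ^+ 2 -
      csc gamma ^+ 2 / 2 * (opnorm (Im_mx A) ^+ 2 - opnorm (Re_mx A) ^+ 2)).
  (* Writing the sine as a square root gathers the right side under one radical, so that only
     radicands need comparing. *)
  have sE : sin gamma = Num.sqrt (sin gamma ^+ 2).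
    by rewrite sqrtr_sqr (ger0_norm (ltW s0)).
  rewrite [X in _ <= _ * X * _]sE -sqrtrM // -sqrtrM; last first.
    by apply: mulr_ge0 => //; exact: sqr_ge0.
  apply: ler_wsqrtr.
  have {hIm} : opnorm (Im_mx A) ^+ 2 <= sin gamma ^+ 2 * numradius A ^+ 2.
    rewrite -exprMn ler_sqr // nnegrE ?opnorm_ge0 //.
    by apply: mulr_ge0; [exact: ltW|exact: numradius_ge0].
  have sc : sin gamma ^+ 2 * csc gamma ^+ 2 = 1.
    by rewrite /csc -exprMn divff ?expr1n // gt_eqF.
  by move=> hIm; exact: cartesian_radicand_le.
(* To be used with [s = 1] and [s = -1]. *)
have key (s : R[i]) : normc s = 1 ->
    numradius (A *m X *m B + s *: (B *m Y *m A)) <=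
    2 * Num.sqrt 2 * sin gamma * opnorm B * Num.max (opnorm X) (opnorm Y) *
    Num.sqrt (numradius A ^+ 2 -
      csc gamma ^+ 2 / 2 * (opnorm (Im_mx A) ^+ 2 - opnorm (Re_mx A) ^+ 2)).
  move=> s1; apply: le_trans (numradius_mulmx_pair_le A B s1 XM YM) _.
  have assoc (b m t r v : R) : 2 * t * r * b * m * v = 2 * b * m * (t * r * v).
    by ring.
  rewrite assoc; apply: ler_wpM2l hsqrt; apply: mulr_ge0 M0.
  by apply: mulr_ge0 => //; exact: opnorm_ge0.
split; first by rewrite -[B *m Y *m A]scale1r; apply: key; exact: normc1.
by rewrite -scaleN1r; apply: key; exact: etrans (normcN _) (normc1 _).
Qed.
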